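(* Let $\nu, m_1, m_2, t$ be positive integers with $m_1\ge m_2\ge t$ and $2\nu\ge 2m_1+m_2+1$. Suppose $\mathcal F_1\subseteq\mathcal P_{m_1}$ and $\mathcal F_2\subseteq\mathcal P_{m_2}$ are cross $t$-intersecting families such that $|\mathcal F_1|\cdot|\mathcal F_2|$ is maximum among all pairs of cross $t$-intersecting families $\mathcal F_1\subseteq\mathcal P_{m_1}$, $\mathcal F_2\subseteq\mathcal P_{m_2}$. Then there exists a $t$-dimensional totally isotropic subspace contained in every member of $\mathcal F_1$ and of $\mathcal F_2$.
   Context: Let $q$ be a prime power, $\nu\ge 1$ an integer, and $f$ a non-degenerate alternating bilinear form on $V=\mathbb F_q^{2\nu}$. A subspace $W\le V$ is totally isotropic if $f(x,y)=0$ for all $x,y\in W$ (maximal totally isotropic subspaces have dimension $\nu$). For $0\le m\le \nu$, $\mathcal P_m$ denotes the set of all $m$-dimensional totally isotropic subspaces of $V$. Families $\mathcal F_1\subseteq\mathcal P_{m_1}$ and $\mathcal F_2\subseteq\mathcal P_{m_2}$ are called cross $t$-intersecting if $\dim(F_1\cap F_2)\ge t$ for all $F_1\in\mathcal F_1$, $F_2\in\mathcal F_2$. *)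

(* Defs.v *)
From HB Require Import structures.
From mathcomp Require Import all_boot all_order all_algebra.
Set Implicit Arguments. Unset Strict Implicit. Unset Printing Implicit Defensive.
Import GRing.Theory.
Local Open Scope ring_scope.
Import VectorInternalTheory.

HB.instance Definition _ (F : finFieldType) (n : nat) :=
  [Finite of {vspace 'rV[F]_n} by <:].

Section Symplectic.
Variables (F : finFieldType) (n : nat).
Notation V := 'rV[F]_n.

Definition bform (M : 'M[F]_n) (x y : V) : F := (x *m M *m y^T) 0 0.

Definition alt_form (M : 'M[F]_n) : Prop := forall x : V, bform M x x = 0.

Definition nondeg_form (M : 'M[F]_n) : Prop :=
  forall x : V, (forall y : V, bform M x y = 0) -> x = 0.

Definition tot_isotropic (M : 'M[F]_n) (W : {vspace V}) : bool :=
  [forall x : V, forall y : V, (x \in W) ==> (y \in W) ==> (bform M x y == 0)].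

Definition Piso (M : 'M[F]_n) (m : nat) : {set {vspace V}} :=
  [set W : {vspace V} | (\dim W == m)%N && tot_isotropic M W].

Definition cross_t_intersecting (t : nat) (F1 F2 : {set {vspace V}}) : Prop :=
  forall A B, A \in F1 -> B \in F2 -> (t <= \dim (A :&: B))%N.

End Symplectic.

(* Main.v *)
(** A subspace T covers a family at level t if every member meets T in dimension
    at least t.  Let t + a and t + b be the least dimensions of covers of F1 and
    F2, with C a least cover of F2.  A member of F2 contains a t-subspace of C,
    which leaves at most [t + b choose t] <= q^((t+1)b) choices.  A subspace H of
    dimension between t and t + a - 1 does not cover F1, so some A in F1 meets it
    in dimension less than t; double counting pairs (x, B) with x in A and B in F2
    above H + <x> shows that passing from H to some H + <x> loses at most a factor
    q^(m1-t+1).  Writing c_m(k) for the number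
    of isotropic m-spaces above an isotropic k-space, this gives
      |F2| <= q^((t+1)b + (m1-t+1)a) c_{m2}(t+a),
    and symmetrically for F1.  The bound on nu yields
      q^(m1+2) c_{m2}(k+1) < c_{m2}(k)  and  q^(m2+2) c_{m1}(k+1) < c_{m1}(k),
    so |F1| |F2| < c_{m1}(t) c_{m2}(t) unless a = b = 0, whereas the families of
    all isotropic spaces above one t-space attain this product.  Pairing the
    cover of F2 (rather than all of A) with the branching over F1 is what keeps
    the bound on nu independent of t. *)
Require Import Defs.
From HB Require Import structures.
From mathcomp Require Import all_boot all_order all_algebra all_field.
From mathcomp Require Import zify.
Local Open Scope ring_scope.

(** * Double counting and branching in a family of subspaces *)

Section Counting.
Set Implicit Arguments. Unset Strict Implicit. Unset Printing Implicit Defensive.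
Variables (F : finFieldType) (n : nat).
Notation V := 'rV[F]_n.
Notation q := #|F|.
Implicit Types (U W H C T : {vspace V}) (G : {set {vspace V}}).

Definition above G H := [set B in G | (H <= B)%VS].

Lemma card_gt1 : (1 < q)%N.
Proof. exact: finNzRing_gt1. Qed.

Lemma card_vspaceD U W :
  #|[set x : V | (x \in U) && (x \notin W)]| = (q ^ \dim U - q ^ \dim (U :&: W))%N.
Proof.
have -> : (q ^ \dim U = #|[set x | x \in U]|)%N by rewrite cardsE card_vspace.
have -> : (q ^ \dim (U :&: W) = #|[set x | x \in U] :&: [set x | x \in W]|)%N.
  rewrite -card_vspace -cardsE; apply: eq_card => x.
  by rewrite !inE memv_cap.
rewrite -cardsD; apply: eq_card => x; by rewrite !inE andbC.
Qed.

Lemma dim_add_line H (x : V) : x \notin H -> \dim (H + <[x]>) = (\dim H).+1.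
Proof.
move=> xH; have := dimv_sum_cap H <[x]>.
have x0 : x != 0 by apply: contra xH => /eqP->; rewrite mem0v.
have -> : (H :&: <[x]> = 0)%VS.
  apply/eqP; rewrite -subv0; apply/subvP => y; rewrite memv_cap => /andP[yH].
  case/vlineP => k yk; rewrite memv0 yk; apply/eqP; move: yH; rewrite yk GRing.rpredZeq.
  by rewrite (negbTE xH) orbF => /eqP ->; rewrite GRing.scale0r.
by rewrite dimv0 addn0 dim_vline x0 addn1.
Qed.

Lemma double_count G H C :
  (\sum_(B in above G H) #|[set x : V | (x \in (B :&: C)%VS) && (x \notin H)]|
   = \sum_(x : V | (x \in C) && (x \notin H)) #|above G (H + <[x]>)%VS|)%N.
Proof.
under eq_bigr do rewrite -sum1dep_card.
rewrite (exchange_big_dep (fun x => (x \in C) && (x \notin H))) /=; last first.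
  by move=> B x _; rewrite memv_cap -andbA => /and3P[_ -> ->].
apply: eq_bigr => x /andP[xC xH].
rewrite -sum1dep_card; apply: eq_bigl => B.
by rewrite !inE memv_cap xC xH !andbT subv_add memvE andbA.
Qed.

(** Every [B] above [H] satisfies [B :&: C :&: H = C :&: H], so it contains at least
    [q ^ t - q ^ \dim (C :&: H)] vectors of [C] outside [H]; each of these vectors lies in at most
    [N] such [B]. *)
Lemma branch G H C t N :
  (\dim (C :&: H) < t)%N ->
  (forall B, B \in G -> (t <= \dim (B :&: C))%N) ->
  (forall x, x \in C -> x \notin H -> (#|above G (H + <[x]>)%VS| <= N)%N) ->
  (#|above G H| * (q ^ t - q ^ \dim (C :&: H)) <=
   (q ^ \dim C - q ^ \dim (C :&: H)) * N)%N.
Proof.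
move=> ct GC GN.
have := double_count G H C.
set L := (\sum_(B in _) _)%N; set R := (\sum_(x | _) _)%N => LR.
have : (R <= \sum_(x : V | (x \in C) && (x \notin H)) N)%N.
  by apply: leq_sum => x /andP[xC xH]; exact: GN.
rewrite sum_nat_cond_const card_vspaceD => RN.
apply: leq_trans RN; rewrite -LR -sum_nat_const; apply: leq_sum => B.
rewrite inE => /andP[BG HB]; rewrite card_vspaceD.
have -> : (B :&: C :&: H = C :&: H)%VS.
  by rewrite capvC capvA (capv_idPl HB) capvC.
apply: leq_sub2r; rewrite leq_exp2l ?card_gt1 //; exact: GC.
Qed.

Lemma above0 G : above G 0 = G.
Proof. by apply/setP => B; rewrite inE sub0v andbT. Qed.

(** For [c < t] the ratio of [q ^ m - q ^ c] to [q ^ t - q ^ c] is at most [q ^ (m - t + 1)],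
    because [q >= 2] lets [q ^ m.+1] absorb both [q ^ m] and [q ^ (m - t + 1 + c)]. *)
Lemma card_above_branch G (H C : {vspace V}) m t N :
  (\dim C = m)%N -> (t <= m)%N -> (\dim (C :&: H) < t)%N ->
  (forall B, B \in G -> (t <= \dim (B :&: C))%N) ->
  (forall H', \dim H' = (\dim H).+1 -> (#|above G H'| <= N)%N) ->
  (#|above G H| <= q ^ (m - t + 1) * N)%N.
Proof.
move=> Cm tm ct GC GN.
have := @branch G H C t N ct GC (fun x _ xH => GN _ (dim_add_line xH)).
rewrite Cm; set c := \dim _ in ct *.
have q1 := card_gt1; have q0 : (0 < q)%N by exact: ltnW.
have ht : (q ^ c < q ^ t)%N by rewrite ltn_exp2l.
have le : (q ^ m - q ^ c <= q ^ (m - t + 1) * (q ^ t - q ^ c))%N.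
  rewrite mulnBr -!expnD.
  have -> : (m - t + 1 + t = m.+1)%N by lia.
  have h1 : (q ^ (m - t + 1 + c) <= q ^ m)%N by rewrite leq_exp2l //; lia.
  have h2 : (2 * q ^ m <= q ^ m.+1)%N by rewrite expnS leq_mul2r q1 orbT.
  lia.
move=> le2; rewrite -(leq_pmul2r (m := q ^ t - q ^ c)) ?subn_gt0 //.
apply: leq_trans le2 _; rewrite mulnAC leq_mul2r le orbT //.
Qed.

(** * Gaussian binomials and families with given covers *)

(* The Gaussian binomial [t + b choose t] is
   [qfact (t + b) / (qfact t * qfact b)]. *)
Definition qfact k := (\prod_(i < k) (q ^ i.+1 - 1))%N.

Lemma qfact0 : qfact 0 = 1%N.
Proof. exact: big_ord0. Qed.

Lemma qfactS k : qfact k.+1 = (qfact k * (q ^ k.+1 - 1))%N.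
Proof. by rewrite /qfact big_ord_recr. Qed.

Lemma qfact_gt0 k : (0 < qfact k)%N.
Proof.
apply: prodn_gt0 => i; rewrite subn_gt0 -(exp1n i.+1) ltn_exp2r //.
exact: card_gt1.
Qed.

(** Factor by factor, [q ^ (t + b).+1 - 1] is at most [q ^ t.+1] times [q ^ b.+1 - 1]. *)
Lemma qfactD t b : (qfact (t + b) <= q ^ (t.+1 * b) * (qfact t * qfact b))%N.
Proof.
have q1 := card_gt1; have q0 : (0 < q)%N by exact: ltnW.
elim: b => [|b IH]; first by rewrite muln0 addn0 expn0 mul1n qfact0 muln1.
rewrite addnS !qfactS mulnS expnD.
have le : (q ^ (t + b).+1 - 1 <= q ^ t.+1 * (q ^ b.+1 - 1))%N.
  rewrite mulnBr muln1 -expnD.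
  have -> : (t.+1 + b.+1 = (t + b).+2)%N by lia.
  have h1 : (q ^ t.+1 <= q ^ (t + b).+1)%N by rewrite leq_exp2l //; lia.
  have h2 : (2 * q ^ (t + b).+1 <= q ^ (t + b).+2)%N.
    by rewrite [X in (_ <= X)%N]expnS leq_mul2r q1 orbT.
  have h3 : (0 < q ^ t.+1)%N by rewrite expn_gt0 q0.
  lia.
by apply: leq_trans (leq_mul IH le) _; apply: eq_leq; lia.
Qed.

(** Between [H] and [C] lie [d + b choose d] subspaces of dimension [t], and each member above [H]
    contains one. They are never enumerated: a use of [branch] inside [C] contributes exactly the
    ratio of two consecutive Gaussian binomials. *)
Lemma card_above_cover G C H t b d N :
  (forall B, B \in G -> (t <= \dim (B :&: C))%N) -> \dim C = (t + b)%N ->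
  (forall T, (T <= C)%VS -> \dim T = t -> (#|above G T| <= N)%N) ->
  (H <= C)%VS -> (\dim H + d = t)%N ->
  (#|above G H| * (qfact d * qfact b) <= qfact (d + b) * N)%N.
Proof.
move=> GC Cd GN; elim: d H => [|d IH] H HC Hd.
  rewrite add0n qfact0 mul1n mulnC leq_mul2l.
  by rewrite GN ?orbT // -Hd addn0.
have q1 := card_gt1; have q0 : (0 < q)%N by exact: ltnW.
have CH : (C :&: H = H)%VS by apply/capv_idPr.
have pos : (0 < qfact d * qfact b)%N by rewrite muln_gt0 !qfact_gt0.
have Ht : (\dim H < t)%N by lia.
(* The inductive bound comes multiplied by [qfact d * qfact b], so [branch] gets a floor quotient;
   multiplying back can only decrease it. *)
have HN x : x \in C -> x \notin H ->
    (#|above G (H + <[x]>)| <= qfact (d + b) * N %/ (qfact d * qfact b))%N.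
  move=> xC xH; rewrite leq_divRL //; apply: IH.
    by rewrite subv_add HC -memvE.
  by rewrite dim_add_line //; lia.
have := branch (N := qfact (d + b) * N %/ (qfact d * qfact b)) _ GC HN.
rewrite CH Cd => /(_ Ht).
set h := \dim H in Hd *.
have -> : (q ^ t - q ^ h = q ^ h * (q ^ d.+1 - 1))%N.
  by rewrite mulnBr muln1 -expnD Hd.
have -> : (q ^ (t + b) - q ^ h = q ^ h * (q ^ (d + b).+1 - 1))%N.
  by rewrite mulnBr muln1 -expnD; congr (q ^ _ - _)%N; lia.
rewrite mulnCA -[X in (_ <= X)%N]mulnA leq_pmul2l ?expn_gt0 ?q0 // => le.
rewrite addSn !qfactS.
have := leq_mul le (leqnn (qfact d * qfact b)).
have := leq_divM (qfact (d + b) * N) (qfact d * qfact b).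
set Y := (_ %/ _)%N; set P := (qfact d * qfact b)%N => l1 l2.
set z := (q ^ (d + b).+1 - 1)%N in l2 *.
have l3 := leq_mul (leqnn z) l1.
have -> : (#|above G H| * (qfact d * (q ^ d.+1 - 1) * qfact b) =
           #|above G H| * (q ^ d.+1 - 1) * P)%N.
  by rewrite /P; lia.
apply: leq_trans l2 _; rewrite -mulnA; apply: leq_trans l3 _.
by rewrite mulnCA mulnA.
Qed.

Lemma card_above_noncover (G1 G2 : {set {vspace V}}) m t s d N H :
  (t <= m)%N -> (forall A, A \in G1 -> \dim A = m) ->
  cross_t_intersecting t G1 G2 ->
  (forall H', (\dim H' < s)%N -> exists2 A, A \in G1 & (\dim (A :&: H') < t)%N) ->
  (forall H', \dim H' = s -> (#|above G2 H'| <= N)%N) ->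
  (\dim H + d = s)%N ->
  (#|above G2 H| <= q ^ ((m - t + 1) * d) * N)%N.
Proof.
move=> tm G1m cr nc GN; elim: d H => [|d IH] H Hd.
  by rewrite muln0 mul1n GN // -Hd addn0.
have [A AG At] := nc H ltac:(lia).
rewrite mulnS expnD -mulnA.
apply: (@card_above_branch G2 H A) => //; first exact: G1m.
  by move=> B BG; rewrite capvC; exact: cr.
by move=> H' dH'; apply: IH; lia.
Qed.

(** Two stages: from [0] up to the [t]-subspaces of the cover [C], then from these to dimension
    [t + a] by branching over members of [G1]. *)
Lemma card_le_covers (G1 G2 : {set {vspace V}}) m t a b C N :
  (t <= m)%N -> (forall A, A \in G1 -> \dim A = m) ->
  cross_t_intersecting t G1 G2 ->
  (forall H, (\dim H < t + a)%N -> exists2 A, A \in G1 & (\dim (A :&: H) < t)%N) ->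
  \dim C = (t + b)%N -> (forall B, B \in G2 -> (t <= \dim (B :&: C))%N) ->
  (forall H, \dim H = (t + a)%N -> (#|above G2 H| <= N)%N) ->
  (#|G2| <= q ^ (t.+1 * b + (m - t + 1) * a) * N)%N.
Proof.
move=> tm G1m cr nc Cd GC GN.
have TN T : (T <= C)%VS -> \dim T = t ->
    (#|above G2 T| <= q ^ ((m - t + 1) * a) * N)%N.
  by move=> _ Td; apply: (card_above_noncover tm G1m cr nc GN); rewrite Td.
have := card_above_cover GC Cd TN (sub0v C).
rewrite above0 dimv0 => /(_ t erefl).
have pos : (0 < qfact t * qfact b)%N by rewrite muln_gt0 !qfact_gt0.
move=> le; rewrite -(leq_pmul2r pos); apply: leq_trans le _.
rewrite expnD -(mulnA _ _ N) (mulnAC _ (_ * N)%N) leq_mul2r.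
by rewrite qfactD orbT.
Qed.

(** * Orthogonal complements and isotropic subspaces *)

Section Isotropic.
Variable M : 'M[F]_n.
Implicit Types K : {vspace V}.

Definition basis_mx K : 'M[F]_(\dim K, n) := \matrix_i (vbasis K)`_i.

Lemma mul_basis_mx K (v : 'rV_(\dim K)) :
  v *m basis_mx K = \sum_i v 0 i *: (vbasis K)`_i.
Proof. by rewrite mulmx_sum_row; apply: eq_bigr => i _; rewrite rowK. Qed.

Lemma basis_mx_free K : row_free (basis_mx K).
Proof.
apply: inj_row_free => v; rewrite mul_basis_mx => v0.
apply/rowP => i; rewrite mxE.
by have /freeP -> := basis_free (vbasisP K).
Qed.

(** Written as the kernel of a single matrix product, so that its dimension comes from rank and
    nullity. *)
Definition perp K : {vspace V} :=
  lker (linfun (mulmxr (M *m (basis_mx K)^T) : V -> 'rV_(\dim K))).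

Lemma perpP K (x : V) : reflect (forall y, y \in K -> bform M x y = 0) (x \in perp K).
Proof.
rewrite memv_ker lfunE /= mulmxA; apply: (iffP eqP) => [x0 y | x0].
  move=> /coord_vbasis ->; set v : 'rV_(\dim K) := \row_i coord (vbasis K) i y.
  have -> : \sum_(i < \dim K) coord (vbasis K) i y *: (vbasis K)`_i = v *m basis_mx K.
    by rewrite mul_basis_mx; apply: eq_bigr => i _; rewrite mxE.
  by rewrite /bform trmx_mul mulmxA x0 mul0mx mxE.
apply/rowP => i; rewrite [RHS]mxE -(x0 (vbasis K)`_i); last first.
  by apply: vbasis_mem; rewrite mem_nth // size_tuple.
by rewrite /bform !mxE; apply: eq_bigr => j _; rewrite !mxE.
Qed.

Hypothesis altM : alt_form M.
Hypothesis ndM : nondeg_form M.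

Lemma nondeg_unit : M \in unitmx.
Proof.
rewrite -row_free_unit; apply: inj_row_free => v v0.
by apply: ndM => y; rewrite /bform v0 mul0mx mxE.
Qed.

Lemma dim_perp K : (\dim (perp K) = n - \dim K)%N.
Proof.
set A := M *m (basis_mx K)^T.
have full : row_full A.
  rewrite /row_full -mxrank_tr trmx_mul trmxK mxrankMfree; last first.
    by rewrite row_free_unit unitmx_tr nondeg_unit.
  exact: basis_mx_free.
case/row_fullP: full => B BA.
have := limg_ker_dim (linfun (mulmxr A : V -> 'rV_(\dim K))) fullv.
have -> : limg (linfun (mulmxr A : V -> 'rV_(\dim K))) = fullv.
  apply/vspaceP => y; rewrite memvf; apply/memv_imgP; exists (y *m B).
    exact: memvf.
  by rewrite lfunE /= -mulmxA BA mulmx1.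
rewrite capfv !dimvf.
have dr k : dim 'rV[F]_k = k by rewrite /dim /= mul1n.
by rewrite !dr => /(canRL (addnK _)).
Qed.

Lemma bformDl (x y z : V) : bform M (x + y) z = bform M x z + bform M y z.
Proof. by rewrite /bform !mulmxDl mxE. Qed.

Lemma bformDr (x y z : V) : bform M z (x + y) = bform M z x + bform M z y.
Proof. by rewrite /bform GRing.raddfD mulmxDr mxE. Qed.

Lemma bformZl a (x y : V) : bform M (a *: x) y = a * bform M x y.
Proof. by rewrite /bform -!scalemxAl mxE. Qed.

Lemma bformZr a (x y : V) : bform M x (a *: y) = a * bform M x y.
Proof. by rewrite /bform GRing.linearZ /= -scalemxAr mxE. Qed.

Lemma bformC (x y : V) : bform M x y = - bform M y x.
Proof.
have := altM (x + y); rewrite bformDl !bformDr !altM GRing.add0r GRing.addr0.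
by move/eqP; rewrite GRing.addr_eq0 => /eqP.
Qed.

Lemma isoP K : reflect (forall x y, x \in K -> y \in K -> bform M x y = 0)
  (tot_isotropic M K).
Proof.
apply: (iffP forallP) => [h x y xK yK | h x].
  by have /forallP/(_ y) := h x; rewrite xK yK => /eqP.
apply/forallP => y; apply/implyP => xK; apply/implyP => yK.
by rewrite h.
Qed.

Lemma isoS K K' : (K <= K')%VS -> tot_isotropic M K' -> tot_isotropic M K.
Proof.
move=> /subvP s /isoP h; apply/isoP => x y xK yK.
by rewrite h ?s.
Qed.

Lemma iso_sub_perp K : tot_isotropic M K -> (K <= perp K)%VS.
Proof. by move/isoP => h; apply/subvP => x xK; apply/perpP => y; exact: h. Qed.

(** Alternation makes the form vanish on the line itself, leaving only the pairing of [x] with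
    [K]. *)
Lemma iso_add_line K (x : V) :
  tot_isotropic M K -> tot_isotropic M (K + <[x]>) = (x \in perp K).
Proof.
move=> /isoP h; apply/isoP/perpP => [hx y yK | hx u v].
  apply: hx; last by rewrite memvE (subv_trans _ (addvSl _ _)) -?memvE.
  by rewrite memvE addvSr.
case/memv_addP => u1 u1K [_ /vlineP[a ->] ->].
case/memv_addP => v1 v1K [_ /vlineP[b ->] ->].
rewrite !bformDl !bformDr !bformZl !bformZr altM h // (bformC u1) !hx //.
by rewrite !(GRing.mulr0, GRing.oppr0, GRing.addr0).
Qed.

(** * Counting isotropic subspaces above a given one *)

(* Solves the recurrence of [iso_double_count] for the number of [m]-dimensional
   isotropic subspaces above an isotropic one of dimension [m - d]; the division
   is exact. *)
Fixpoint iso_count (m d : nat) : nat :=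
  if d is e.+1 then
    let k := (m - d)%N in
    ((q ^ (n - k) - q ^ k) * iso_count m e) %/ (q ^ m - q ^ k)
  else 1%N.

Lemma above_Piso0 m H : ~~ tot_isotropic M H -> above (Piso M m) H = set0.
Proof.
move=> nH; apply/setP => B; rewrite !inE.
by apply: contraNF nH => /andP[/andP[_ iB] HB]; exact: isoS iB.
Qed.

(** This is [double_count] with [C = perp K], which contains every isotropic [B] above [K] and whose
    vectors are those that extend [K] isotropically. *)
Lemma iso_double_count m K N : (\dim K < m)%N -> tot_isotropic M K ->
  (forall K', tot_isotropic M K' -> \dim K' = (\dim K).+1 -> #|above (Piso M m) K'| = N) ->
  (#|above (Piso M m) K| * (q ^ m - q ^ \dim K) = (q ^ (n - \dim K) - q ^ \dim K) * N)%N.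
Proof.
move=> Km iK hN.
have := double_count (Piso M m) K (perp K).
under eq_bigr => B.
  rewrite !inE -andbA => /and3P[/eqP Bm iB KB].
  have -> : (B :&: perp K = B)%VS.
    apply/capv_idPl/subvP => x xB; apply/perpP => y yK.
    by move/isoP: iB => -> //; exact: (subvP KB).
  rewrite card_vspaceD Bm (capv_idPr KB).
  over.
rewrite sum_nat_const => ->.
rewrite -(dim_perp K) -[X in (_ - q ^ X)%N](congr1 _ (capv_idPr (iso_sub_perp iK))).
rewrite -card_vspaceD -sum_nat_cond_const; apply: eq_bigr => x /andP[xp xK].
by apply: hN; rewrite ?iso_add_line // dim_add_line.
Qed.

Lemma card_above_iso m d K : tot_isotropic M K -> (\dim K + d = m)%N ->
  #|above (Piso M m) K| = iso_count m d.
Proof.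
elim: d K => [|d IH] K iK Kd.
  rewrite /= -[RHS](cards1 K); apply: eq_card => B; rewrite !inE.
  apply/andP/eqP => [[/andP[/eqP Bm _] KB] | ->]; last by rewrite -Kd addn0 eqxx iK subvv.
  by apply/eqP; rewrite eq_sym eqEdim KB Bm -Kd addn0 leqnn.
have Km : (\dim K < m)%N by lia.
have := iso_double_count Km iK (fun K' iK' dK' => IH K' iK' ltac:(lia)).
rewrite /= -/(iso_count m d) (_ : m - d.+1 = \dim K)%N; last lia.
move=> <-; rewrite mulnK // subn_gt0 ltn_exp2l //; exact: card_gt1.
Qed.

Lemma iso0 : tot_isotropic M 0.
Proof.
by apply/isoP => x y; rewrite !memv0 => /eqP -> _; rewrite /bform !mul0mx mxE.
Qed.

Lemma card_above_iso_gt0 m K : (2 * m <= n)%N -> tot_isotropic M K -> (\dim K <= m)%N ->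
  (0 < #|above (Piso M m) K|)%N.
Proof.
move=> mn; move Ed : (m - \dim K)%N => d.
elim: d K Ed => [|d IH] K Ed iK Km.
  apply/card_gt0P; exists K; rewrite !inE subvv iK !andbT; apply/eqP; lia.
have hN K' : tot_isotropic M K' -> \dim K' = (\dim K).+1 ->
    #|above (Piso M m) K'| = iso_count m d.
  by move=> iK' dK'; apply: card_above_iso iK' _; lia.
have Kltm : (\dim K < m)%N by lia.
have e := iso_double_count Kltm iK hN.
have q1 := card_gt1.
have : (q ^ \dim K < q ^ (n - \dim K))%N by rewrite ltn_exp2l //; lia.
rewrite -subn_gt0 => p1.
have [x /andP[xp xK]] : exists x, (x \in perp K) && (x \notin K).
  have : (0 < #|[set x : V | (x \in perp K) && (x \notin K)]|)%N.
    by rewrite card_vspaceD (capv_idPr (iso_sub_perp iK)) dim_perp.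
  by case/card_gt0P => x; rewrite inE; exists x.
have iKx : tot_isotropic M (K + <[x]>) by rewrite iso_add_line.
have dKx := dim_add_line xK.
have p2 : (0 < #|above (Piso M m) (K + <[x]>)|)%N by apply: IH => //; rewrite dKx; lia.
rewrite lt0n; apply/negP => /eqP z.
by move/esym/eqP: e; rewrite z mul0n -(hN _ iKx dKx) muln_eq0 !eqn0Ngt p1 p2.
Qed.

Lemma card_above_Piso_le m k (G : {set {vspace V}}) H :
  G \subset Piso M m -> \dim H = k -> (k <= m)%N -> (#|above G H| <= iso_count m (m - k))%N.
Proof.
move=> GP Hk km; apply: (@leq_trans #|above (Piso M m) H|).
  apply/subset_leq_card/subsetP => B; rewrite !inE => /andP[/(subsetP GP) + ->].
  by rewrite inE => ->.
have [iH|nH] := boolP (tot_isotropic M H); last by rewrite above_Piso0 // cards0.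
by rewrite (card_above_iso (d := m - k) iH) ?Hk ?subnKC.
Qed.

Lemma exists_iso k : (2 * k <= n)%N -> exists2 K, tot_isotropic M K & \dim K = k.
Proof.
move=> kn; have := card_above_iso_gt0 kn iso0.
rewrite dimv0 => /(_ isT)/card_gt0P[K]; rewrite !inE => /andP[/andP[/eqP Kk iK] _].
by exists K.
Qed.

Lemma iso_count_gt0 m k : (2 * m <= n)%N -> (k <= m)%N -> (0 < iso_count m (m - k))%N.
Proof.
move=> mn km; have [|K iK Kk] := @exists_iso k; first lia.
have Kd : (\dim K + (m - k) = m)%N by rewrite Kk subnKC.
by rewrite -(card_above_iso iK Kd) card_above_iso_gt0 // Kk.
Qed.

(** The two counts have ratio [q ^ (n - k) - q ^ k] to [q ^ m - q ^ k]; strictness comes from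
    [q ^ k < q ^ (e + k)]. *)
Lemma iso_count_decay m k e : (2 * m <= n)%N -> (k < m)%N -> (0 < e)%N ->
  (m + k + e <= n)%N -> (q ^ e * iso_count m (m - k.+1) < iso_count m (m - k))%N.
Proof.
move=> mn km e0 le; have [|K iK Kk] := @exists_iso k; first lia.
have q1 := card_gt1; have q0 : (0 < q)%N by exact: ltnW.
have Kd : (\dim K + (m - k) = m)%N by rewrite Kk; lia.
have hN K' : tot_isotropic M K' -> \dim K' = (\dim K).+1 ->
    #|above (Piso M m) K'| = iso_count m (m - k.+1).
  by move=> iK' dK'; apply: card_above_iso iK' _; rewrite dK' Kk; lia.
have Km : (\dim K < m)%N by rewrite Kk.
have E := iso_double_count Km iK hN.
rewrite (card_above_iso iK Kd) Kk in E.
have p : (0 < q ^ m - q ^ k)%N by rewrite subn_gt0 ltn_exp2l.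
rewrite -(ltn_pmul2r p) E mulnAC ltn_pmul2r ?iso_count_gt0 //.
have h1 : (q ^ (e + m) <= q ^ (n - k))%N by rewrite leq_exp2l //; lia.
have h2 : (q ^ k < q ^ (e + k))%N by rewrite ltn_exp2l //; lia.
have h3 : (q ^ (e + k) < q ^ (e + m))%N by rewrite ltn_exp2l //; lia.
rewrite mulnBr -!expnD; lia.
Qed.

(** The last step starts from dimension at most [m - 1], whence [n.+1] in the bound. The equality
    case later forces minimal covers to have dimension [t]. *)
Lemma iso_count_decay_iter m k e a : (2 * m <= n)%N -> (k + a <= m)%N -> (0 < e)%N ->
  (2 * m + e <= n.+1)%N ->
  (q ^ (e * a) * iso_count m (m - (k + a)) <= iso_count m (m - k) ?= iff (a == 0))%N.
Proof.
move=> mn; elim: a => [|a IH] kam e0 le.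
  by rewrite muln0 mul1n addn0; apply/leqif_refl.
apply/leqifP => /=.
apply: (@leq_trans (q ^ (e * a) * iso_count m (m - (k + a)))); last first.
  by apply: IH => //; lia.
rewrite mulnSr expnD -mulnA ltn_pmul2l ?expn_gt0 ?(ltnW card_gt1) //.
by rewrite addnS; apply: iso_count_decay => //; lia.
Qed.

(** * Minimal covers and bounds for cross-intersecting families *)

Lemma minimal_cover t m (G : {set {vspace V}}) C :
  G != set0 -> \dim C = m -> (forall A, A \in G -> (t <= \dim (A :&: C))%N) ->
  exists D a, [/\ \dim D = (t + a)%N, (t + a <= m)%N,
    (forall A, A \in G -> (t <= \dim (A :&: D))%N) &
    (forall H, (\dim H < t + a)%N -> exists2 A, A \in G & (\dim (A :&: H) < t)%N)].
Proof.
move=> G0 Cm GC.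
pose cov (D : {vspace V}) := [forall A in G, t <= \dim (A :&: D)]%N.
have covP D : reflect (forall A, A \in G -> (t <= \dim (A :&: D))%N) (cov D).
  exact: forall_inP.
have [D /covP covD Dmin] := arg_minnP (P := cov) (fun D => \dim D) (introT (covP C) GC).
exists D, (\dim D - t)%N.
(* Nonemptiness of [G] ensures that [\dim D - t] is not truncated. *)
have tD : (t <= \dim D)%N.
  case/set0Pn: G0 => A /covD tA; apply: leq_trans tA _.
  exact/dimvS/capvSr.
rewrite subnKC //; split=> //; first by rewrite -Cm; apply: Dmin; apply/covP.
move=> H HD; have : ~~ cov H by apply: contraL HD => /Dmin; rewrite leqNgt.
by rewrite negb_forall_in => /exists_inP[A AG]; rewrite -ltnNge; exists A.
Qed.

Lemma card_cross_le m m' t a b (G1 G2 : {set {vspace V}}) D :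
  G1 \subset Piso M m -> G2 \subset Piso M m' -> (t <= m)%N -> (t + a <= m')%N ->
  cross_t_intersecting t G1 G2 ->
  (forall H, (\dim H < t + a)%N -> exists2 A, A \in G1 & (\dim (A :&: H) < t)%N) ->
  \dim D = (t + b)%N -> (forall B, B \in G2 -> (t <= \dim (B :&: D))%N) ->
  (#|G2| <= q ^ (t.+1 * b + (m - t + 1) * a) * iso_count m' (m' - (t + a)))%N.
Proof.
move=> G1P G2P tm tam cr nc Dd G2D; apply: (card_le_covers tm _ cr nc Dd G2D).
  by move=> A /(subsetP G1P); rewrite inE => /andP[/eqP].
by move=> H Hd; apply: card_above_Piso_le.
Qed.

(* If some [B] did not contain [T], every member of [G1] would contain [T] and a
   further vector of [B], which makes [G1] smaller than [iso_count]. *)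
Lemma cover_contained m m' t (G1 G2 : {set {vspace V}}) T :
  (2 * m + (m' + 2) <= n.+1)%N -> (t <= m)%N -> (t <= m')%N ->
  G1 \subset Piso M m -> G2 \subset Piso M m' ->
  cross_t_intersecting t G1 G2 -> G1 != set0 ->
  (iso_count m (m - t) <= #|G1|)%N ->
  \dim T = t -> (forall A, A \in G1 -> (T <= A)%VS) ->
  forall B, B \in G2 -> (T <= B)%VS.
Proof.
move=> mn tm tm' G1P G2P cr /set0Pn[A0 A0G] big Tt TG B BG.
suff le : (t <= \dim (B :&: T))%N.
  suff -> : T = (B :&: T)%VS by exact: capvSl.
  by apply/eqP; rewrite eq_sym eqEdim capvSr Tt.
rewrite leqNgt; apply/negP => lt.
have aT : above G1 T = G1.
  by apply/setP => A; rewrite inE andb_idr //; exact: TG.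
(* The decay estimate needs [t < m]; if [t = m], then [T] is itself the member [A0], which meets [B]
   in dimension at least [t]. *)
move: (tm); rewrite leq_eqVlt => /orP[/eqP tm_eq | tm_lt].
  have : T = A0.
    apply/eqP; rewrite eqEdim TG //=.
    by have := subsetP G1P _ A0G; rewrite inE => /andP[/eqP -> _]; rewrite Tt tm_eq.
  move=> e; have := cr _ _ A0G BG; rewrite -e capvC leqNgt lt //.
have Bm : \dim B = m' by have := subsetP G2P _ BG; rewrite inE => /andP[/eqP].
have := @card_above_branch G1 T B m' t (iso_count m (m - t.+1)) Bm tm' lt.
rewrite aT Tt => le1.
have {}le1 := le1 (fun A AG => cr _ _ AG BG)
   (fun H' dH' => card_above_Piso_le G1P dH' tm_lt).
have := @iso_count_decay m t (m' - t + 1) ltac:(lia) tm_lt ltac:(lia) ltac:(lia).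
by rewrite ltnNge (leq_trans big le1).
Qed.

End Isotropic.
End Counting.

Theorem theorem1p1 (F : finFieldType) (nu m1 m2 t : nat) (M : 'M[F]_(2 * nu))
  (F1 F2 : {set {vspace 'rV[F]_(2 * nu)}}) :
  (0 < nu)%N -> (0 < t)%N -> (t <= m2)%N -> (m2 <= m1)%N ->
  (2 * m1 + m2 + 1 <= 2 * nu)%N ->
  alt_form M -> nondeg_form M ->
  F1 \subset Piso M m1 -> F2 \subset Piso M m2 ->
  cross_t_intersecting t F1 F2 ->
  (forall G1 G2 : {set {vspace 'rV[F]_(2 * nu)}},
     G1 \subset Piso M m1 -> G2 \subset Piso M m2 ->
     cross_t_intersecting t G1 G2 ->
     (#|G1| * #|G2| <= #|F1| * #|F2|)%N) ->
  exists T : {vspace 'rV[F]_(2 * nu)},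
    [/\ T \in Piso M t,
        (forall A, A \in F1 -> (T <= A)%VS) &
        (forall B, B \in F2 -> (T <= B)%VS)].
Proof.
move=> _ t0 tm2 m21; set n := (2 * nu)%N => hn altM ndM F1P F2P cr maxF.
have tm1 : (t <= m1)%N by apply: leq_trans m21.
pose c m k := iso_count F n m (m - k).
have cr' : cross_t_intersecting t F2 F1 by move=> B A BF AF; rewrite capvC; exact: cr.
have q1 := card_gt1 F; have q0 : (0 < #|F|)%N by exact: ltnW.
have big : (c m1 t * c m2 t <= #|F1| * #|F2|)%N.
  have [|K iK Kt] := exists_iso altM ndM (k := t); first lia.
  have cK m : (t <= m)%N -> #|above (Piso M m) K| = c m t.
    by move=> tm; apply: card_above_iso => //; rewrite Kt subnKC.
  rewrite -!cK //; apply: maxF.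
  - by apply/subsetP => B; rewrite inE => /andP[].
  - by apply/subsetP => B; rewrite inE => /andP[].
  move=> A B; rewrite inE => /andP[_ KA]; rewrite inE => /andP[_ KB].
  by rewrite -Kt dimvS // subv_cap KA.
have pos1 : (0 < c m1 t)%N by apply: iso_count_gt0 => //; lia.
have pos2 : (0 < c m2 t)%N by apply: iso_count_gt0 => //; lia.
have /andP[F1n F2n] : (0 < #|F1|)%N && (0 < #|F2|)%N.
  by rewrite -muln_gt0 (leq_trans _ big) // muln_gt0 pos1.
move: (F1n) (F2n); rewrite !card_gt0 => F10 F20.
have /set0Pn[A0 A0F] := F10; have /set0Pn[B0 B0F] := F20.
have dF1 A : A \in F1 -> \dim A = m1.
  by move/(subsetP F1P); rewrite inE => /andP[/eqP].
have dF2 B : B \in F2 -> \dim B = m2.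
  by move/(subsetP F2P); rewrite inE => /andP[/eqP].
have [T1 [a [T1d am T1c T1m]]] :=
  minimal_cover F10 (dF2 _ B0F) (fun A AF => cr _ _ AF B0F).
have [T2 [b [T2d bm T2c T2m]]] :=
  minimal_cover F20 (dF1 _ A0F) (fun B BF => cr' _ _ BF A0F).
have le2 := card_cross_le altM ndM F1P F2P tm1 am cr T1m T2d T2c.
have le1 := card_cross_le altM ndM F2P F1P tm2 bm cr' T2m T1d T1c.
(* Of these decay conditions, [n1] is exactly the hypothesis on [nu], and [n2] follows from it by
   [m2 <= m1]. *)
have n2 : (2 * m2 + (m1 + 2) <= n.+1)%N by lia.
have n1 : (2 * m1 + (m2 + 2) <= n.+1)%N by lia.
have D2 := iso_count_decay_iter altM ndM (m := m2) (k := t) (e := m1 + 2) (a := a)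
   ltac:(lia) am ltac:(lia) n2.
have D1 := iso_count_decay_iter altM ndM (m := m1) (k := t) (e := m2 + 2) (a := b)
   ltac:(lia) bm ltac:(lia) n1.
(* In the product, [a] collects [t + 1] from [le1] and [m1 - t + 1] from [le2], in all [m1 + 2];
   likewise [b] collects [m2 + 2]. *)
have ub : (#|F1| * #|F2| <= (#|F| ^ ((m2 + 2) * b) * c m1 (t + b)) *
                            (#|F| ^ ((m1 + 2) * a) * c m2 (t + a)))%N.
  apply: leq_trans (leq_mul le1 le2) _.
  rewrite -/(c _ _) -/(c _ _) !(mulnACA _ (c _ _)) leq_mul2r; apply/orP; right.
  rewrite -!expnD leq_exp2l //; apply/eq_leq.
  have -> : (m2 - t + 1 = (m2 + 2) - t.+1)%N by lia.
  have -> : (m1 - t + 1 = (m1 + 2) - t.+1)%N by lia.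
  have h1 : (t.+1 <= m1 + 2)%N by lia.
  have h2 : (t.+1 <= m2 + 2)%N by lia.
  rewrite -(subnK h1) -(subnK h2) !addnK; lia.
(* The chain from [big] through [ub] to the decay bounds closes up, so equality holds throughout;
   positivity excludes the degenerate equality of zero products. *)
have /andP[/eqP a0 /eqP b0] : (a == 0) && (b == 0).
  have D := leqif_mul D1 D2.
  have eq := D.2; rewrite andbC.
  move: eq; rewrite eqn_leq D.1 -/(c _ _) -/(c _ _) (leq_trans big ub) /=.
  by rewrite muln_eq0 !eqn0Ngt pos1 pos2 /= => <-.
subst a b; rewrite !addn0 in T1d T2d le1 le2.
rewrite !muln0 !mul1n -/(c _ _) in le1 le2.
have c1F : (c m1 t <= #|F1|)%N.
  by rewrite -(leq_pmul2r pos2) (leq_trans big) // leq_mul2l le2 orbT.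
have T1F A : A \in F1 -> (T1 <= A)%VS.
  move=> /T1c le; suff -> : T1 = (A :&: T1)%VS by exact: capvSl.
  by apply/eqP; rewrite eq_sym eqEdim capvSr T1d.
exists T1; split=> //.
  rewrite inE T1d eqxx /=; apply: isoS (T1F _ A0F) _.
  by have := subsetP F1P _ A0F; rewrite inE => /andP[].
(* [T1] was chosen for [F1] alone; the size of [F1] given by [c1F] carries it over to [F2]. *)
exact: (cover_contained altM ndM n1 tm1 tm2 F1P F2P cr F10 c1F T1d T1F).
Qed.
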